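(* For all $p,q\in\mathbb{R}^3$ with $p\ne q$, the relativistic Landau kernel matrix $\Phi=\Phi(p,q)$ can be decomposed as $$\Phi=\Sigma\,\Sigma^\top,$$ where $$\Sigma(p,q)=\frac{\rho+1}{(p^0q^0)^{1/2}}(\rho\tau)^{-3/4}\left\{\begin{bmatrix}q^0p_2-p^0q_2&-(q^0p_3-p^0q_3)&0\\-(q^0p_1-p^0q_1)&0&q^0p_3-p^0q_3\\0&q^0p_1-p^0q_1&-(q^0p_2-p^0q_2)\end{bmatrix}-\frac{1}{p^0+1}(p\times q)\otimes\begin{bmatrix}p_3 \\ p_2 \\ p_1\end{bmatrix}\right\}.$$
   Context: For $p,q\in\mathbb{R}^3$: $p^0=\sqrt{1+|p|^2}$, $q^0=\sqrt{1+|q|^2}$, $\rho=p^0q^0-p\cdot q-1$ (which is $\ge0$ and vanishes only if $p=q$), $\tau=\rho+2$. The kernel is $\Phi^{ij}(p,q)=\Lambda(p,q)S^{ij}(p,q)$, $1\le i,j\le3$, with $$\Lambda(p,q)=\frac{(\rho+1)^2}{p^0q^0}(\rho\tau)^{-3/2},\qquad S^{ij}(p,q)=\rho\tau\,\delta_{ij}-(p_i-q_i)(p_j-q_j)+\rho(p_iq_j+p_jq_i).$$ $a\otimes b$ is the matrix with entries $a_ib_j$, and $\times$ is the cross product in $\mathbb{R}^3$. *)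

(* Defs.v *)
From mathcomp Require Import all_boot all_order all_algebra.
From mathcomp Require Import reals exp.
Set Implicit Arguments.
Unset Strict Implicit.
Unset Printing Implicit Defensive.
Import Order.TTheory GRing.Theory Num.Theory.
Local Open Scope ring_scope.

(* Vectors of R^3 are columns; the indices 0, 1, 2 of 'I_3 stand for the
   mathematical indices 1, 2, 3. *)
Definition x1 (R : realType) (p : 'cV[R]_3) : R := p (@Ordinal 3 0 isT) 0.
Definition x2 (R : realType) (p : 'cV[R]_3) : R := p (@Ordinal 3 1 isT) 0.
Definition x3 (R : realType) (p : 'cV[R]_3) : R := p (@Ordinal 3 2 isT) 0.

Definition vec3 (R : realType) (a b c : R) : 'cV[R]_3 :=
  \col_i nth 0 [:: a; b; c] i.

Definition mx3 (R : realType)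
    (a11 a12 a13 a21 a22 a23 a31 a32 a33 : R) : 'M[R]_3 :=
  \matrix_(i, j) nth 0 (nth [::] [:: [:: a11; a12; a13];
                                     [:: a21; a22; a23];
                                     [:: a31; a32; a33]] i) j.

Definition dot (R : realType) (p q : 'cV[R]_3) : R :=
  \sum_(i < 3) p i 0 * q i 0.

(* The norm `|p| of MathComp-Analysis on matrices is the sup norm, hence this
   separate Euclidean norm. *)
Definition enorm (R : realType) (p : 'cV[R]_3) : R := Num.sqrt (dot p p).

Definition cross (R : realType) (p q : 'cV[R]_3) : 'cV[R]_3 :=
  vec3 (x2 p * x3 q - x3 p * x2 q)
       (x3 p * x1 q - x1 p * x3 q)
       (x1 p * x2 q - x2 p * x1 q).

Definition tensor (R : realType) (a b : 'cV[R]_3) : 'M[R]_3 :=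
  \matrix_(i, j) (a i 0 * b j 0).

Definition energy (R : realType) (p : 'cV[R]_3) : R :=
  Num.sqrt (1 + enorm p ^+ 2).

Definition rho (R : realType) (p q : 'cV[R]_3) : R :=
  energy p * energy q - dot p q - 1.

Definition tau (R : realType) (p q : 'cV[R]_3) : R := rho p q + 2.

(* x `^ a is the usual real power only for 0 < x; every base below is positive
   as soon as p <> q. *)
Definition Lambda (R : realType) (p q : 'cV[R]_3) : R :=
  (rho p q + 1) ^+ 2 / (energy p * energy q)
  * (rho p q * tau p q) `^ (- (3 / 2)).

Definition Smx (R : realType) (p q : 'cV[R]_3) : 'M[R]_3 :=
  \matrix_(i, j)
    (rho p q * tau p q * (i == j)%:R
     - (p i 0 - q i 0) * (p j 0 - q j 0)
     + rho p q * (p i 0 * q j 0 + p j 0 * q i 0)).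

Definition Phi (R : realType) (p q : 'cV[R]_3) : 'M[R]_3 :=
  \matrix_(i, j) (Lambda p q * Smx p q i j).

Definition Sigma (R : realType) (p q : 'cV[R]_3) : 'M[R]_3 :=
  let p0 := energy p in
  let q0 := energy q in
  ((rho p q + 1) / (p0 * q0) `^ (1 / 2)
   * (rho p q * tau p q) `^ (- (3 / 4)))
  *: (mx3
        (q0 * x2 p - p0 * x2 q)    (- (q0 * x3 p - p0 * x3 q)) 0
        (- (q0 * x1 p - p0 * x1 q)) 0                          (q0 * x3 p - p0 * x3 q)
        0                          (q0 * x1 p - p0 * x1 q)     (- (q0 * x2 p - p0 * x2 q))
      - (1 / (p0 + 1)) *: tensor (cross p q) (vec3 (x3 p) (x2 p) (x1 p))).

(* Main.v *)
(* Put w = q0 p - p0 q and c = p x q. The matrix A in the braces of Sigma is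
   v |-> w x v with its columns in reverse order, so A A^T = |w|^2 I - w w^T
   and A (p3, p2, p1)^T = w x p = p0 c. As |p|^2 = (p0 - 1) (p0 + 1), the
   rank-one correction by c turns this into |w|^2 I - w w^T - c c^T, which
   equals S modulo p0^2 = 1 + |p|^2 and q0^2 = 1 + |q|^2. *)
Require Import Defs.
From mathcomp Require Import all_boot all_order all_algebra.
From mathcomp Require Import reals exp.
From mathcomp Require Import ring.
Set Implicit Arguments.
Unset Strict Implicit.
Import Order.TTheory GRing.Theory Num.Theory.
Local Open Scope ring_scope.

(** The bound proof [hk] is arbitrary, so that indices produced by [big_ord_recl] and by case
    analysis all reduce to [x1], [x2], [x3]. *)
Lemma coordE (R : realType) (p : 'cV[R]_3) (k : nat) (hk : (k < 3)%N) :
  p (Ordinal hk) 0 = nth 0 [:: x1 p; x2 p; x3 p] k.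
Proof. by case: k hk => [|[|[|k]]] hk //=; congr (p _ _); apply: val_inj. Qed.

Lemma dot_coord (R : realType) (p q : 'cV[R]_3) :
  dot p q = x1 p * x1 q + x2 p * x2 q + x3 p * x3 q.
Proof. by rewrite /dot !big_ord_recl big_ord0 addr0 addrA !coordE. Qed.

Lemma energy_ge0 (R : realType) (p : 'cV[R]_3) : 0 <= energy p.
Proof. exact: sqrtr_ge0. Qed.

Lemma energy_sqr (R : realType) (p : 'cV[R]_3) :
  energy p ^+ 2 = 1 + x1 p ^+ 2 + x2 p ^+ 2 + x3 p ^+ 2.
Proof.
have dot_ge0 : 0 <= dot p p by rewrite dot_coord -!expr2 !addr_ge0 ?sqr_ge0.
rewrite /energy /enorm sqr_sqrtr ?addr_ge0 ?sqr_ge0 // sqr_sqrtr //.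
by rewrite dot_coord -!expr2 !addrA.
Qed.

Lemma powR_sqr (R : realType) (x a : R) : (x `^ a) ^+ 2 = x `^ (a * 2).
Proof. by rewrite powRrM powR_mulrn ?powR_ge0. Qed.

(** Syntactically the braces of [Sigma], so that the main proof can fold it. *)
Definition Sigma_core (R : realType) (p q : 'cV[R]_3) : 'M[R]_3 :=
  let p0 := energy p in
  let q0 := energy q in
  mx3
    (q0 * x2 p - p0 * x2 q)     (- (q0 * x3 p - p0 * x3 q)) 0
    (- (q0 * x1 p - p0 * x1 q)) 0                           (q0 * x3 p - p0 * x3 q)
    0                           (q0 * x1 p - p0 * x1 q)     (- (q0 * x2 p - p0 * x2 q))
  - (1 / (p0 + 1)) *: tensor (cross p q) (vec3 (x3 p) (x2 p) (x1 p)).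

Lemma Smx_factorization (R : realType) (p q : 'cV[R]_3) :
  Smx p q = Sigma_core p q *m (Sigma_core p q)^T.
Proof.
have hp := energy_sqr p; have hq := energy_sqr q.
have p0D1 : energy p + 1 != 0 by rewrite gt_eqF // ltr_wpDl ?energy_ge0.
apply/matrixP => i j.
rewrite !mxE !big_ord_recl big_ord0 /tau /rho dot_coord !mxE.
(* Each of the nine entries is a rational identity modulo [hp] and [hq], which eliminate the squares
   of the energies; the only denominator is [energy p + 1]. *)
case: i => [[|[|[|i]]] hi] //; case: j => [[|[|[|j]]] hj] //;
  rewrite !coordE -?val_eqE /=; field: hp hq; exact: p0D1.
Qed.

Theorem proposition2p3 (R : realType) (p q : 'cV[R]_3) (hpq : p <> q) :
  Phi p q = Sigma p q *m (Sigma p q)^T.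
Proof.
have -> : Phi p q = Lambda p q *: Smx p q by apply/matrixP => i j; rewrite !mxE.
rewrite /Sigma /= -/(Sigma_core p q) linearZ /= -scalemxAl -scalemxAr scalerA.
rewrite -Smx_factorization; congr (_ *: _).
(* It remains to check that the squared prefactor of [Sigma] is [Lambda]: squaring doubles the
   exponents 1/2 and -3/4. *)
rewrite -expr2 !exprMn exprVn !powR_sqr /Lambda.
have -> : 1 / 2 * 2 = 1 :> R by field.
have -> : - (3 / 4) * 2 = - (3 / 2) :> R by field.
by rewrite powRr1 // mulr_ge0 ?energy_ge0.
Qed.
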